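(* Let $n\ge1$, let $A=(a_{r,c})_{1\le r,c\le n}$ have all entries nonzero, and let $\lambda_a,\mu_a$ be parameters. Let $H$ be the vector space with basis $|x,y\rangle$, $x,y\in\mathbb Z$, $x+y$ even, with dual vectors $\langle u,v|$, $\langle u,v|x,y\rangle=\delta_{u,x}\delta_{v,y}$. Define operators $\hat w|x,y\rangle=|x+1,y+1\rangle$, $\hat z|x,y\rangle=|x+1,y-1\rangle$, and diagonal operators $\hat\alpha|x,y\rangle=\alpha_{x,y}|x,y\rangle$, $\hat\ell|x,y\rangle=\lambda_{y+1-n}|x,y\rangle$, $\hat m|x,y\rangle=\mu_x|x,y\rangle$, where $\alpha_{x,y}=a_{\frac{x-y}{2}+n,\frac{x+y}{2}+1}$ whenever these indices lie in $\{1,\dots,n\}$ (and $\alpha_{x,y}$ is an arbitrary nonzero number otherwise). Let $T=\hat w\hat\ell+\hat w\hat m\hat\alpha^{-1}\hat z\hat\alpha+\hat\alpha^{-1}\hat z\hat\alpha$ and $(I-T)^{-1}=\sum_{k\ge0}T^k$. Then $$|A|_{\lambda,\mu}=\det_{1\le i,j\le n}\ \langle 0,0|\,\hat w^{1-j}\,\hat\alpha\,(I-T)^{-1}\,\hat z^{1-i}\,|0,0\rangle .$$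
   Context: Generalized Lambda-determinant: given $A$ and parameters $(\lambda_a),(\mu_a)$, define $T_{i,j,k}$ for $i,j\in\mathbb Z$, $k\ge 0$, $i+j+k\equiv n \pmod 2$, by $T_{i,j,0}=1$ ($i+j\equiv n$ mod 2), $T_{i,j,1}=a_{\frac{j-i+n+1}{2},\frac{i+j+n+1}{2}}$ ($i+j\equiv n+1$ mod 2, $|i|+|j|\le n-1$), and $T_{i,j,k+1}T_{i,j,k-1}=\mu_j\,T_{i,j+1,k}T_{i,j-1,k}+\lambda_i\,T_{i+1,j,k}T_{i-1,j,k}$; then $|A|_{\lambda,\mu}:=T_{0,0,n}$. Each matrix element $\langle u,v|T^k|x,y\rangle$ vanishes unless $u-x\ge k$, so the matrix elements of $(I-T)^{-1}$ are finite sums; $\langle 0,0|\hat w^{1-j}=\langle j-1,j-1|$ and $\hat z^{1-i}|0,0\rangle=|1-i,i-1\rangle$. *)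

(* Defs.v *)
From HB Require Import structures.
From mathcomp Require Import all_boot all_order all_algebra.
From mathcomp Require Import fraction zify.
From mathcomp.multinomials Require Import freeg mpoly.

Set Implicit Arguments.
Unset Strict Implicit.
Unset Printing Implicit Defensive.

Import GRing.Theory.
Local Open Scope ring_scope.

Local Notation "x %:F" := (tofrac x) : ring_scope.

(* The entry a_{r,c} with the indices running from 1 to n; outside this range
   the value 0 is a dummy, never referred to below. *)
Definition entry (F : fieldType) (n : nat) (A : 'M[F]_n) (r c : int) : F :=
  if (r, c) is (Posz r'.+1, Posz c'.+1) then
    if (insub r', insub c') is (Some i, Some j) then A i j else 0
  else 0.

(* The initial data determine T_{i,j,k} exactly for |i| + |j| + k <= n, so the
   equations are required there. *)
Definition T_system (F : fieldType) (n : nat) (A : 'M[F]_n)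
    (lam mu : int -> F) (T : int -> int -> nat -> F) : Prop :=
  [/\ forall i j : int, (i + j = n %[mod 2])%Z ->
        (`|i| + `|j| <= n)%N -> T i j 0 = 1,
      forall i j : int, (i + j = n%:Z + 1 %[mod 2])%Z ->
        (`|i| + `|j| + 1 <= n)%N ->
        T i j 1 = entry A ((j - i + n%:Z + 1) %/ 2)%Z
                          ((i + j + n%:Z + 1) %/ 2)%Z
    & forall (i j : int) (k : nat), (1 <= k)%N ->
        (i + j + k.+1%:Z = n %[mod 2])%Z -> (`|i| + `|j| + k.+1 <= n)%N ->
        T i j k.+1 * T i j k.-1
          = mu j * T i (j + 1) k * T i (j - 1) k
            + lam i * T (i + 1) j k * T (i - 1) j k].

(* |A|_{lam,mu} is T_{0,0,n} as a rational function of the entries and of the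
   parameters, evaluated at the given data. This is needed because for special
   data some intermediate T_{i,j,k} may vanish, and the recursion cannot be run
   numerically. The indeterminates are the a_{r,c} and the lambda_a, mu_a with
   -n <= a <= n; those with index a are numbered a + n. *)
Definition var (n : nat) : finType :=
  ('I_n * 'I_n + ('I_(2 * n).+1 + 'I_(2 * n).+1))%type.

Notation ratfun K n := {fraction {mpoly K[#|var n|]}}.

Definition indet (K : fieldType) (n : nat) (v : var n) : ratfun K n :=
  ('X_(enum_rank v) : {mpoly K[#|var n|]})%:F.

Definition generic_mx (K : fieldType) (n : nat) : 'M[ratfun K n]_n :=
  \matrix_(r, c) indet K (inl (r, c)).

Definition generic_lam (K : fieldType) (n : nat) (a : int) : ratfun K n :=
  indet K (inr (inl (inord (absz (a + n%:Z))))).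

Definition generic_mu (K : fieldType) (n : nat) (a : int) : ratfun K n :=
  indet K (inr (inr (inord (absz (a + n%:Z))))).

Definition point (K : fieldType) (n : nat) (A : 'M[K]_n) (lam mu : int -> K)
    (v : 'I_#|var n|) : K :=
  match enum_val v with
  | inl (r, c) => A r c
  | inr (inl s) => lam (s%:Z - n%:Z)
  | inr (inr s) => mu (s%:Z - n%:Z)
  end.

(* f is defined at pt, with value v there *)
Definition has_value (K : fieldType) (N : nat) (pt : 'I_N -> K)
    (f : {fraction {mpoly K[N]}}) (v : K) : Prop :=
  exists p q : {mpoly K[N]},
    [/\ q.@[pt] != 0, f = p%:F / q%:F & v = p.@[pt] / q.@[pt]].

(* d = |A|_{lam,mu} *)
Definition is_lambda_det (K : fieldType) (n : nat) (A : 'M[K]_n)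
    (lam mu : int -> K) (d : K) : Prop :=
  exists2 T : int -> int -> nat -> ratfun K n,
    T_system (generic_mx K n) (@generic_lam K n) (@generic_mu K n) T
    & has_value (point A lam mu) (T 0 0 n) d.

Section LambdaDet.
Variable K : fieldType.

Section Value.
Variables (N : nat) (pt : 'I_N -> K).
Local Notation F := {fraction {mpoly K[N]}}.
Implicit Types (f g : F) (u v : K).

Lemma has_value_uniq f u v : has_value pt f u -> has_value pt f v -> u = v.
Proof.
case=> p [q [q0 -> ->]] [p' [q' [q'0 e ->]]].
have nz (r : {mpoly K[N]}) : r.@[pt] != 0 -> r%:F != 0 :> F.
  by apply: contra; rewrite tofrac_eq0 => /eqP ->; rewrite meval0.
move/eqP: e; rewrite GRing.eqr_div ?nz // -!tofracM tofrac_eq => /eqP e.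
by apply/eqP; rewrite GRing.eqr_div // -!mevalM e.
Qed.

Lemma has_value_poly (p : {mpoly K[N]}) : has_value pt p%:F p.@[pt].
Proof.
by exists p, 1; split; rewrite ?meval1 ?oner_neq0 // ?tofrac1 divr1.
Qed.

Lemma has_value1 : has_value pt 1 1.
Proof. by have := has_value_poly 1; rewrite tofrac1 meval1. Qed.

Lemma has_valueM f g u v :
  has_value pt f u -> has_value pt g v -> has_value pt (f * g) (u * v).
Proof.
case=> p [q [q0 -> ->]] [p' [q' [q'0 -> ->]]]; exists (p * p'), (q * q').
by split; rewrite ?mevalM ?mulf_neq0 // ?tofracM mulf_div.
Qed.

Lemma has_valueD f g u v :
  has_value pt f u -> has_value pt g v -> has_value pt (f + g) (u + v).
Proof.
case=> p [q [q0 -> ->]] [p' [q' [q'0 -> ->]]].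
have nz (r : {mpoly K[N]}) : r.@[pt] != 0 -> r%:F != 0 :> F.
  by apply: contra; rewrite tofrac_eq0 => /eqP ->; rewrite meval0.
exists (p * q' + p' * q), (q * q').
split; first by rewrite mevalM mulf_neq0.
  by rewrite addf_div ?nz // tofracD !tofracM.
by rewrite addf_div // mevalD !mevalM.
Qed.

Lemma has_value_neq0 f u : has_value pt f u -> u != 0 -> f != 0.
Proof.
move=> fu; apply: contra => /eqP f0; apply/eqP; apply: has_value_uniq fu _.
by rewrite f0; have := has_value_poly 0; rewrite tofrac0 meval0.
Qed.

Lemma has_valueV f u : has_value pt f u -> u != 0 -> has_value pt f^-1 u^-1.
Proof.
case=> p [q [q0 -> ->]] pq0; exists q, p; split; rewrite ?invf_div //.
by apply: contra pq0 => /eqP ->; rewrite mul0r.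
Qed.

End Value.

Variable n : nat.
Local Notation F := (ratfun K n).

Lemma entry_generic A lam mu r c : (0 < r <= n%:Z) -> (0 < c <= n%:Z) ->
  has_value (point A lam mu) (entry (generic_mx K n) r c) (entry A r c).
Proof.
case: r => [[|r]|r]; case: c => [[|c]|c] // rn cn.
have {}rn : (r < n)%N by lia.
have {}cn : (c < n)%N by lia.
rewrite /entry (insubT (fun r => r < n)%N rn).
rewrite (insubT (fun r => r < n)%N cn) mxE /indet.
set X := ('X_ _); have := has_value_poly (point A lam mu) X.
by rewrite mevalXU /point enum_rankK.
Qed.

Lemma lam_generic A lam mu (a : int) : (`|a| <= n)%N ->
  has_value (point A lam mu) (generic_lam K n a) (lam a).
Proof.
move=> an; rewrite /generic_lam /indet.
set X := ('X_ _); have := has_value_poly (point A lam mu) X.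
rewrite mevalXU /point enum_rankK inordK; last lia.
by congr (has_value _ _ (lam _)); lia.
Qed.

Lemma mu_generic A lam mu (a : int) : (`|a| <= n)%N ->
  has_value (point A lam mu) (generic_mu K n a) (mu a).
Proof.
move=> an; rewrite /generic_mu /indet.
set X := ('X_ _); have := has_value_poly (point A lam mu) X.
rewrite mevalXU /point enum_rankK inordK; last lia.
by congr (has_value _ _ (mu _)); lia.
Qed.

Definition weak_T_system (T : int -> int -> nat -> F) : Prop :=
  [/\ forall i j : int, (i + j = n %[mod 2])%Z ->
        (`|i| + `|j| <= n)%N -> T i j 0 = 1,
      forall i j : int, (i + j = n%:Z + 1 %[mod 2])%Z ->
        (`|i| + `|j| + 1 <= n)%N ->
        T i j 1 = entry (generic_mx K n) ((j - i + n%:Z + 1) %/ 2)%Z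
                          ((i + j + n%:Z + 1) %/ 2)%Z
    & forall (i j : int) (k : nat), (1 <= k)%N ->
        (i + j + k.+1%:Z = n %[mod 2])%Z -> (`|i| + `|j| + k.+1 <= n)%N ->
        T i j k.-1 != 0 ->
        T i j k.+1 * T i j k.-1
          = generic_mu K n j * T i (j + 1) k * T i (j - 1) k
            + generic_lam K n i * T (i + 1) j k * T (i - 1) j k].

Lemma T_value A lam mu (T : int -> int -> nat -> F) (t : int -> int -> nat -> K) :
  weak_T_system T -> T_system A lam mu t ->
  (forall i j k, (i + j + k%:Z = n %[mod 2])%Z ->
    (`|i| + `|j| + k.+2 <= n)%N -> t i j k != 0) ->
  forall k (i j : int), (i + j + k%:Z = n %[mod 2])%Z ->
    (`|i| + `|j| + k <= n)%N -> has_value (point A lam mu) (T i j k) (t i j k).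
Proof.
move=> [T0 T1 TS] [t0 t1 tS] tn0 k.
elim/ltn_ind: k => -[|[|k]] IH i j pij le_n.
- by rewrite T0 ?t0 ?addr0 //; first exact: has_value1; lia.
- by rewrite T1 ?t1; [apply: entry_generic | ..]; lia.
have tk0 : t i j k != 0 by apply: tn0; lia.
have Tk : has_value (point A lam mu) (T i j k) (t i j k) by apply: IH; lia.
have Tk0 := has_value_neq0 Tk tk0.
have eT := TS i j k.+1 isT pij le_n Tk0; have et := tS i j k.+1 isT pij le_n.
rewrite -[T i j _](mulfK Tk0) -[t i j _](mulfK tk0) {}eT {}et.
apply: has_valueM; last exact: has_valueV.
apply: has_valueD; (apply: has_valueM; first apply: has_valueM);
  first [by apply: mu_generic; lia | by apply: lam_generic; lia
        | by apply: IH; lia].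
Qed.

Lemma weak_T_system_neq0 T : weak_T_system T ->
  forall k (i j : int), (i + j + k%:Z = n %[mod 2])%Z ->
    (`|i| + `|j| + k <= n)%N -> T i j k != 0.
Proof.
move=> wT k i j pij le_n.
have t1 : T_system (const_mx 1 : 'M[K]_n) (fun=> 0) (fun=> 1) (fun _ _ _ => 1).
  split=> // {k pij le_n} [i' j' pij le_n|i' j' k _ _ _]; last first.
    by rewrite !mul0r !mulr1 addr0.
  set r := (_ %/ _)%Z; set c := (_ %/ _)%Z.
  have : (0 < r <= n%:Z) by lia. have : (0 < c <= n%:Z) by lia.
  case: r => [[|r]|r]; case: c => [[|c]|c] // cn rn.
  have {}rn : (r < n)%N by lia.
  have {}cn : (c < n)%N by lia.
  rewrite /entry (insubT (fun r => r < n)%N rn).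
  by rewrite (insubT (fun r => r < n)%N cn) mxE.
apply: (has_value_neq0 (T_value wT t1 _ pij le_n)); last exact: oner_neq0.
by move=> *; exact: oner_neq0.
Qed.

Lemma T_system_weak T :
  T_system (generic_mx K n) (@generic_lam K n) (@generic_mu K n) T ->
  weak_T_system T.
Proof. by case=> T0 T1 TS; split=> // i j k k1 pij le_n _; apply: TS. Qed.

Lemma generic_T_system_uniq T T' :
  T_system (generic_mx K n) (@generic_lam K n) (@generic_mu K n) T ->
  T_system (generic_mx K n) (@generic_lam K n) (@generic_mu K n) T' ->
  forall k (i j : int), (i + j + k%:Z = n %[mod 2])%Z ->
    (`|i| + `|j| + k <= n)%N -> T i j k = T' i j k.
Proof.
move=> sT sT' k; have nz := weak_T_system_neq0 (T_system_weak sT).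
case: sT sT' => [T0 T1 TS] [T0' T1' TS'].
elim/ltn_ind: k => -[|[|k]] IH i j pij le_n.
- by rewrite T0 ?T0' //; lia.
- by rewrite T1 ?T1' //; lia.
have k0 : T i j k != 0 by apply: nz; lia.
apply: (mulIf k0); rewrite (TS i j k.+1 isT pij le_n) [T i j k]IH; try lia.
by rewrite (TS' i j k.+1 isT pij le_n) ![T _ _ k.+1]IH //; lia.
Qed.

Fixpoint Trec (k : nat) (i j : int) : F :=
  if k is k1.+1 then
    if k1 is k2.+1 then
      (generic_mu K n j * Trec k1 i (j + 1) * Trec k1 i (j - 1)
       + generic_lam K n i * Trec k1 (i + 1) j * Trec k1 (i - 1) j)
        / Trec k2 i j
    else entry (generic_mx K n) ((j - i + n%:Z + 1) %/ 2)%Z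
                          ((i + j + n%:Z + 1) %/ 2)%Z
  else 1.

Lemma generic_T_system_ex : exists T,
  T_system (generic_mx K n) (@generic_lam K n) (@generic_mu K n) T.
Proof.
exists (fun i j k => Trec k i j).
have wT : weak_T_system (fun i j k => Trec k i j).
  by split=> // i j [|k] // _ _ _ /= k0; rewrite divfK.
have nz := weak_T_system_neq0 wT.
case: wT => T0 T1 TS; split=> // i j k k1 pij le_n.
by apply: TS => //; apply: nz; lia.
Qed.

Lemma is_lambda_det_uniq (A : 'M[K]_n) lam mu d d' :
  is_lambda_det A lam mu d -> is_lambda_det A lam mu d' -> d = d'.
Proof.
case=> T sT vT [T' sT' vT']; apply: has_value_uniq vT _.
by rewrite (generic_T_system_uniq sT sT') //; lia.
Qed.

(* When the recursion can be run numerically, it computes |A|_{lam,mu}. *)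
Lemma is_lambda_det_numeric (A : 'M[K]_n) lam mu (t : int -> int -> nat -> K) :
  T_system A lam mu t ->
  (forall i j k, (i + j + k%:Z = n %[mod 2])%Z ->
    (`|i| + `|j| + k.+2 <= n)%N -> t i j k != 0) ->
  is_lambda_det A lam mu (t 0 0 n).
Proof.
move=> st nz; have [T sT] := generic_T_system_ex; exists T => //.
by apply: (T_value (T_system_weak sT) st nz); lia.
Qed.

End LambdaDet.

Definition site : choiceType := {p : int * int | (2 %| p.1 + p.2)%Z}.

Definition xco (p : site) : int := (val p).1.
Definition yco (p : site) : int := (val p).2.

Fact site0_subproof : (2 %| (0, 0).1 + (0, 0).2)%Z.
Proof. by []. Qed.

Fact shift_subproof (p : site) (dx dy : int) : (2 %| dx + dy)%Z ->
  (2 %| (xco p + dx, yco p + dy).1 + (xco p + dx, yco p + dy).2)%Z.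
Proof. by move=> d; rewrite /= addrACA; apply: rpredD => //; exact: (valP p). Qed.

Definition site0 : site := Sub (0, 0) site0_subproof.
Definition shift (dx dy : int) (d : (2 %| dx + dy)%Z) (p : site) : site :=
  Sub (xco p + dx, yco p + dy) (shift_subproof p d).

Section Operators.
Variable K : fieldType.

Definition Hspace : lmodType K := {freeg site / K}.

Definition ket (p : site) : Hspace := << p >>.
Definition bra (p : site) (v : Hspace) : K := coeff p v.

Definition linext (f : site -> Hspace) (v : Hspace) : Hspace := fglift f v.

Definition shift_op (dx dy : int) (d : (2 %| dx + dy)%Z) : Hspace -> Hspace :=
  linext (fun p => ket (shift d p)).
Definition diag_op (f : site -> K) : Hspace -> Hspace := linext (fun p => f p *: ket p).

Definition w_op : Hspace -> Hspace := @shift_op 1 1 isT.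
Definition z_op : Hspace -> Hspace := @shift_op 1 (-1) isT.
Definition w_inv : Hspace -> Hspace := @shift_op (-1) (-1) isT.
Definition z_inv : Hspace -> Hspace := @shift_op (-1) 1 isT.

Lemma linext_ket f p : linext f (ket p) = f p.
Proof. by rewrite /linext /ket liftU scale1r. Qed.

Lemma ket_scale (c : K) p : c *: ket p = << c *g p >>.
Proof.
by apply/eqP/freeg_eqP => q; rewrite coeffZ /ket !coeffU mul1r.
Qed.

Lemma sum_ket (v : Hspace) : \sum_(p <- dom v) bra p v *: ket p = v.
Proof.
rewrite -[RHS]freeg_sumE; apply: eq_bigr => p _; exact: ket_scale.
Qed.

Lemma linext_is_additive f : additive (linext f).
Proof. exact: lift_is_additive. Qed.

HB.instance Definition _ f :=
  GRing.isAdditive.Build Hspace Hspace (linext f) (linext_is_additive f).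

Lemma linext_is_scalable f : scalable (linext f).
Proof.
have Zket c p : linext f (c *: ket p) = c *: f p.
  by rewrite ket_scale /linext liftU.
move=> c v; rewrite -(sum_ket v).
move: (dom v) (fun p => bra p v) => s g.
rewrite scaler_sumr !raddf_sum; apply: eq_bigr => p _ /=.
by rewrite scalerA !Zket scalerA.
Qed.

HB.instance Definition _ f :=
  GRing.isScalable.Build K Hspace Hspace *:%R (linext f) (linext_is_scalable f).

Lemma shift_opK (dx dy dx' dy' : int) (d : (2 %| dx + dy)%Z)
    (d' : (2 %| dx' + dy')%Z) :
  dx + dx' = 0 -> dy + dy' = 0 -> cancel (shift_op d) (shift_op d').
Proof.
move=> ex ey v; rewrite -{1}(sum_ket v) /shift_op !raddf_sum /=.
rewrite -[RHS]sum_ket; apply: eq_bigr => p _.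
rewrite !linearZ /= !linext_ket; congr (_ *: ket _); apply: val_inj.
by rewrite /= /xco /yco /= -!addrA ex ey !addr0 -surjective_pairing.
Qed.

Lemma w_opK : cancel w_op w_inv. Proof. exact: shift_opK. Qed.
Lemma w_invK : cancel w_inv w_op. Proof. exact: shift_opK. Qed.
Lemma z_opK : cancel z_op z_inv. Proof. exact: shift_opK. Qed.
Lemma z_invK : cancel z_inv z_op. Proof. exact: shift_opK. Qed.

Definition T_op (n : nat) (lam mu : int -> K) (alpha : site -> K) (v : Hspace) : Hspace :=
  let l_op := diag_op (fun p => lam (yco p + 1 - n%:Z)) in
  let m_op := diag_op (fun p => mu (xco p)) in
  let a_op := diag_op alpha in
  let a_inv := diag_op (fun p => (alpha p)^-1) in
  w_op (l_op v) + w_op (m_op (a_inv (z_op (a_op v)))) + a_inv (z_op (a_op v)).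

(* s = sum_{k >= 0} phi (U^k v), a sum with finitely many nonzero terms; this
   is how <phi| (I - U)^{-1} |v> is understood. *)
Definition resolvent_elt (phi : Hspace -> K) (U : Hspace -> Hspace) (v : Hspace) (s : K) : Prop :=
  exists2 N : nat, (forall k, (N <= k)%N -> phi (iter k U v) = 0)
    & s = \sum_(k < N) phi (iter k U v).

End Operators.

(* Main.v *)
Require Import Defs.
From mathcomp.multinomials Require Import freeg mpoly.
From mathcomp Require Import all_boot all_order all_algebra.
From mathcomp Require Import fraction zify ring.

Set Implicit Arguments.
Unset Strict Implicit.
Unset Printing Implicit Defensive.

Import GRing.Theory.
Local Open Scope ring_scope.

Local Notation "x %:F" := (tofrac x) : ring_scope.

(** The [(i, j)] matrix element is [path_weight i j (n - i) 1]: the sum over the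
lattice paths from the cell [(n - i, 1)] to [(n, j + 1)] of the array [a] (rows
growing downwards) of the weights of their steps

- [(r, c) -> (r, c + 1)]     : [lam (c - r)],
- [(r, c) -> (r + 1, c)]     : [a r c / a (r + 1) c],
- [(r, c) -> (r + 1, c + 1)] : [mu (r + c - n) * a r c / a (r + 1) c],

times the entry at the end point.  Let [D m r c] be the determinant of the
[m x m] matrix of such sums for the block of [a] whose lower left corner is
[(r, c)].  Cutting paths where they enter the second column multiplies the path
matrix by a triangular matrix with diagonal [lam (c - r + i)]; cutting them where
they enter the last row multiplies it by a unitriangular one.  Hence, once a
multiple of the bottom row has been subtracted from the other rows so as to kill
the paths entering the second column in the last row, all the minors in the
Desnanot-Jacobi identity are multiples of determinants [D] of smaller blocks,
and the identity becomes the T-system.  This is applied to an array of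
indeterminates, where no division by zero occurs, and the result is then
specialized. *)

(** * The Desnanot-Jacobi identity *)

Section DesnanotJacobi.

(** Jacobi's complementary minor formula. Take as [C] the first [k.+1] columns of [\adj A] followed
    by the last columns of the identity: [A *m C] is block triangular with diagonal blocks
    [(\det A)%:M] and [drsubmx A], and one factor [\det A] is cancelled. *)
Lemma det_ulsubmx_adj (R : idomainType) k m (A : 'M[R]_(k.+1 + m)) :
  \det A != 0 ->
  \det (ulsubmx (\adj A)) = \det A ^+ k * \det (drsubmx A).
Proof.
move=> A0; apply: (mulfI A0).
have := mul_mx_adj A; rewrite -{1}[A]submxK -{1}[\adj A]submxK mulmx_block.
rewrite scalar_mx_block => /eq_block_mx [e1 _ e3 _].
pose C := block_mx (ulsubmx (\adj A)) 0 (dlsubmx (\adj A)) 1%:M.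
have : \det (A *m C) = \det A ^+ k.+1 * \det (drsubmx A).
  rewrite -{1}[A]submxK mulmx_block e1 e3 !mulmx1 !mulmx0 !add0r.
  by rewrite det_ublock det_scalar.
by rewrite det_mulmx det_lblock det1 mulr1 => ->; rewrite exprS mulrA.
Qed.

Variable R : comNzRingType.

(** A cyclic shift. Written with [lift], it turns the deletion of row 0 into that of the last row,
    so Laplace expansions along these two rows match term by term. *)
Definition last_to_front m (i : 'I_m.+1) : 'I_m.+1 :=
  if unlift ord0 i is Some k then lift ord_max k else ord_max.

Lemma last_to_front0 m : last_to_front (ord0 : 'I_m.+1) = ord_max.
Proof. by rewrite /last_to_front unlift_none. Qed.

Lemma last_to_front_lift m (i : 'I_m) :
  last_to_front (lift ord0 i) = lift ord_max i.
Proof. by rewrite /last_to_front liftK. Qed.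

Lemma det_rowsub_last_to_front m (B : 'M[R]_m.+1) :
  \det (rowsub (@last_to_front m) B) = (-1) ^+ m * \det B.
Proof.
rewrite (expand_det_row _ ord0) (expand_det_row B ord_max) mulr_sumr.
apply: eq_bigr => j _; rewrite mxE last_to_front0 /cofactor add0n exprD.
rewrite [RHS]mulrCA; congr (_ * _); rewrite !mulrA -exprD addnn -mul2n exprM.
rewrite sqrrN expr1n expr1n mul1r; congr (_ * \det _).
by apply/matrixP=> i k; rewrite !mxE last_to_front_lift.
Qed.

Lemma det_colsub_last_to_front m (B : 'M[R]_m.+1) :
  \det (colsub (@last_to_front m) B) = (-1) ^+ m * \det B.
Proof.
rewrite -[in RHS]det_tr -det_rowsub_last_to_front -det_tr; congr (\det _).
by apply/matrixP=> i j; rewrite !mxE.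
Qed.

(** Brings the first and last indices to the two leading positions, so that the 2 x 2 corner of the
    adjugate holds the four minors of the Desnanot-Jacobi identity. *)
Definition last_to_second m (i : 'I_m.+2) : 'I_m.+2 :=
  if unlift ord0 i is Some k then lift ord0 (last_to_front k) else ord0.

Lemma last_to_second0 m : last_to_second (ord0 : 'I_m.+2) = ord0.
Proof. by rewrite /last_to_second unlift_none. Qed.

Lemma last_to_second_lift m (i : 'I_m.+1) :
  last_to_second (lift ord0 i) = lift ord0 (last_to_front i).
Proof. by rewrite /last_to_second liftK. Qed.

Lemma det_rowsub_last_to_second m (A : 'M[R]_m.+2) :
  \det (rowsub (@last_to_second m) A) = (-1) ^+ m * \det A.
Proof.
rewrite (expand_det_row _ ord0) (expand_det_row A ord0) mulr_sumr.
apply: eq_bigr => j _; rewrite mxE last_to_second0 /cofactor add0n.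
rewrite [RHS]mulrCA; congr (_ * _); rewrite [RHS]mulrCA; congr (_ * _).
rewrite -det_rowsub_last_to_front; congr (\det _).
by apply/matrixP=> i k; rewrite !mxE last_to_second_lift.
Qed.

Lemma det_mxsub_last_to_second m (A : 'M[R]_m.+2) :
  \det (mxsub (@last_to_second m) (@last_to_second m) A) = \det A.
Proof.
have -> : mxsub (@last_to_second m) (@last_to_second m) A
   = rowsub (@last_to_second m) (rowsub (@last_to_second m) A^T)^T.
  by apply/matrixP=> i j; rewrite !mxE.
rewrite det_rowsub_last_to_second det_tr det_rowsub_last_to_second det_tr.
by rewrite mulrA -exprD addnn -mul2n exprM sqrrN expr1n expr1n mul1r.
Qed.

End DesnanotJacobi.

Lemma det2 (R : comNzRingType) (A : 'M[R]_2) :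
  \det A = A 0 0 * A 1 1 - A 0 1 * A 1 0.
Proof.
rewrite (expand_det_row _ 0) !big_ord_recl big_ord0 addr0 /cofactor.
rewrite !det_mx11 !mxE /= expr0 mul1r expr1 mulN1r mulrN.
by congr (A _ _ * A _ _ - A _ _ * A _ _); apply: val_inj.
Qed.

Lemma desnanot_jacobi_nonsing (R : idomainType) m (A : 'M[R]_m.+2) :
  \det A != 0 ->
  \det A * \det (\matrix_(i < m, j < m)
                   A (lift ord0 (lift ord_max i)) (lift ord0 (lift ord_max j)))
  = \det (row' ord_max (col' ord_max A)) * \det (row' ord0 (col' ord0 A))
    - \det (row' ord_max (col' ord0 A)) * \det (row' ord0 (col' ord_max A)).
Proof.
move=> A0; pose f := @last_to_second m.
pose B : 'M[R]_(2 + m) := mxsub f f A.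
have dB : \det B = \det A by exact: det_mxsub_last_to_second.
have := @det_ulsubmx_adj R 1 m B; rewrite dB expr1 => /(_ A0) e.
have -> : \matrix_(i < m, j < m) A (lift ord0 (lift ord_max i))
    (lift ord0 (lift ord_max j)) = drsubmx B.
  apply/matrixP=> i j; rewrite !mxE.
  have fr (k : 'I_m) : f (rshift 2 k) = lift ord0 (lift ord_max k).
    rewrite -last_to_front_lift -last_to_second_lift; congr last_to_second.
    exact: val_inj.
  by rewrite !fr.
rewrite -e det2 !mxE.
(* Deleting index 0 of [B] leaves the indices cyclically shifted, at the cost of a sign [(-1) ^+ m];
   deleting index 1 leaves them in natural order. The signs cancel in both products. *)
have f0 (k : 'I_m.+1) :
    f (lift (lshift m (0 : 'I_2)) k) = lift ord0 (last_to_front k).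
  by rewrite -last_to_second_lift; congr last_to_second; exact: val_inj.
have f1 (k : 'I_m.+1) : f (lift (lshift m (1 : 'I_2)) k) = lift ord_max k.
  case: (unliftP ord0 k) => [k' ->|->].
    have -> : lift (lshift m (1 : 'I_2)) (lift ord0 k') = lift ord0 (lift ord0 k').
      by apply: val_inj => /=; rewrite /bump /=; lia.
    rewrite /f last_to_second_lift last_to_front_lift.
    by apply: val_inj => /=; rewrite /bump /=; lia.
  have -> : lift (lshift m (1 : 'I_2)) ord0 = ord0 :> 'I_m.+2 by exact: val_inj.
  by rewrite /f last_to_second0; apply: val_inj.
have c00 : cofactor B (lshift m 0) (lshift m 0) = \det (row' ord0 (col' ord0 A)).
  rewrite /cofactor expr0 mul1r -[RHS]mul1r -(sqrr_sign R m) expr2 -mulrA.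
  rewrite -det_colsub_last_to_front -det_rowsub_last_to_front.
  by congr (\det _); apply/matrixP=> i j; rewrite !mxE !f0.
have c01 : cofactor B (lshift m 0) (lshift m 1)
         = - ((-1) ^+ m * \det (row' ord0 (col' ord_max A))).
  rewrite /cofactor expr1 mulN1r -det_rowsub_last_to_front.
  by congr (- \det _); apply/matrixP=> i j; rewrite !mxE f0 f1.
have c10 : cofactor B (lshift m 1) (lshift m 0)
         = - ((-1) ^+ m * \det (row' ord_max (col' ord0 A))).
  rewrite /cofactor expr1 mulN1r -det_colsub_last_to_front.
  by congr (- \det _); apply/matrixP=> i j; rewrite !mxE f0 f1.
have c11 : cofactor B (lshift m 1) (lshift m 1)
         = \det (row' ord_max (col' ord_max A)).
  rewrite /cofactor -signr_odd expr0 mul1r.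
  by congr (\det _); apply/matrixP=> i j; rewrite !mxE !f1.
by rewrite c00 c01 c10 c11 mulrNN mulrACA -expr2 sqrr_sign mul1r mulrC.
Qed.

Lemma desnanot_jacobi (R : idomainType) m (A : 'M[R]_m.+2) :
  \det A * \det (\matrix_(i < m, j < m)
                   A (lift ord0 (lift ord_max i)) (lift ord0 (lift ord_max j)))
  = \det (row' ord_max (col' ord_max A)) * \det (row' ord0 (col' ord0 A))
    - \det (row' ord_max (col' ord0 A)) * \det (row' ord0 (col' ord_max A)).
Proof.
(* ['X + A] is nonsingular over [{poly R}] and specializes to [A] at 0. *)
pose h : {rmorphism {poly R} -> R} := horner_eval (0 : R).
pose B := char_poly_mx (- A).
have hB : map_mx h B = A.
  apply/matrixP=> i j; rewrite !mxE /= /horner_eval hornerD hornerN hornerC.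
  by rewrite hornerMn hornerX mul0rn sub0r opprK.
have B0 : \det B != 0 by exact: monic_neq0 (char_poly_monic _).
have /(congr1 h) := desnanot_jacobi_nonsing B0.
rewrite rmorphB !rmorphM -!det_map_mx.
rewrite !map_row' !map_col' hB => <-.
by congr (_ * \det _); apply/matrixP=> i j; rewrite -hB !mxE.
Qed.
(** Left multiplication by a lower triangular matrix with diagonal [1 - s 0, 1, ..., 1]; row 0
    itself may be rescaled. *)
Lemma det_sub_row0 (R : comNzRingType) m (B : 'M[R]_m.+1)
    (s : 'I_m.+1 -> R) :
  \det (\matrix_(i, j) (B i j - s i * B 0 j)) = (1 - s 0) * \det B.
Proof.
pose L : 'M[R]_m.+1 := \matrix_(i, j) ((i == j)%:R - s i * (j == 0)%:R).
have -> : \matrix_(i, j) (B i j - s i * B 0 j) = L *m B.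
  apply/matrixP=> i j; rewrite !mxE.
  under eq_bigr do rewrite mxE mulrBl.
  rewrite sumrB (bigD1 i) //= eqxx mul1r big1 ?addr0; last first.
    by move=> k /negPf ki; rewrite eq_sym ki mul0r.
  rewrite (bigD1 0) //= mulr1 big1 ?addr0 // => k /negPf k0.
  by rewrite k0 mulr0 mul0r.
rewrite det_mulmx; congr (_ * _).
rewrite det_trig; last first.
  apply/is_trig_mxP => i j ij; rewrite mxE.
  have -> : (i == j) = false by apply/eqP => e; rewrite e ltnn in ij.
  have -> : (j == 0) = false by apply/eqP => e; rewrite e in ij.
  by rewrite mulr0 subr0.
rewrite big_ord_recl big1 ?mulr1 => [|i _]; rewrite mxE eqxx.
  by rewrite mulr1.
by rewrite mulr0 subr0.
Qed.

Lemma det_sub_col0 (R : comNzRingType) m (B : 'M[R]_m.+1)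
    (s : 'I_m.+1 -> R) :
  \det (\matrix_(i, j) (B i j - B i 0 * s j)) = (1 - s 0) * \det B.
Proof.
rewrite -[\det B]det_tr -det_sub_row0 -det_tr; congr (\det _).
by apply/matrixP=> i j; rewrite !mxE mulrC.
Qed.

(** * Path matrices *)

Section PathMatrix.
Variables (F : fieldType) (n : int) (a : int -> int -> F) (lam mu : int -> F).

(** [p] rows and [q] columns remain to be crossed; the inner [fix] handles the horizontal step,
    which decreases [q] alone. For [q = 0] the ratios of the vertical steps telescope against the
    end entry, leaving [a r c] whatever [p] is. *)
Fixpoint path_weight (p : nat) : nat -> int -> int -> F :=
  fix path_weight_p q r c :=
    if q is q'.+1 then
      lam (c - r) * path_weight_p q' r (c + 1)
      + (if p is p'.+1 then
           a r c / a (r + 1) c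
           * (path_weight p' q (r + 1) c
              + mu (r + c - n) * path_weight p' q' (r + 1) (c + 1))
         else 0)
    else a r c.

Arguments path_weight : simpl never.

Lemma path_weight0 p r c : path_weight p 0 r c = a r c.
Proof. by case: p. Qed.

Lemma path_weight0S q r c :
  path_weight 0 q.+1 r c = lam (c - r) * path_weight 0 q r (c + 1).
Proof. by rewrite {1}/path_weight /= addr0. Qed.

Lemma path_weightSS p q r c :
  path_weight p.+1 q.+1 r c = lam (c - r) * path_weight p.+1 q r (c + 1)
  + a r c / a (r + 1) c * (path_weight p q.+1 (r + 1) c
                           + mu (r + c - n) * path_weight p q (r + 1) (c + 1)).
Proof. by []. Qed.

Definition path_mx m (r c : int) : 'M[F]_m :=
  \matrix_(i < m, j < m) path_weight i j (r - i%:Z) c.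

Hypothesis a_neq0 : forall r c, a r c != 0.
Hypothesis lam_neq0 : forall s, lam s != 0.

(* The weight of the paths from [(r - i, c)] until they enter column [c + 1], in
   row [r - k]. *)
Definition col_transfer (r c : int) (i k : nat) : F :=
  if (k < i)%N then
    a (r - i%:Z) c / a (r - k%:Z) c
    * (lam (c - r + k%:Z) + mu (r - k%:Z + c - 1 - n))
  else if k == i then lam (c - r + k%:Z) else 0.

(** Induction on [i] by the first step. Column [c + 1] is entered in row [r - k] horizontally
    ([lam]) or, if [k < i], also diagonally from the row above ([mu]); the vertical ratios before
    that telescope. *)
Lemma path_weight_col_transfer i q (r c : int) :
  path_weight i q.+1 (r - i%:Z) c
  = \sum_(k < i.+1) col_transfer r c i k * path_weight k q (r - k%:Z) (c + 1).
Proof.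
elim: i => [|i IHi].
  rewrite big_ord1 /col_transfer /= path_weight0S.
  by congr (lam _ * _); lia.
rewrite path_weightSS big_ord_recr /= {2}/col_transfer ltnn eqxx [LHS]addrC.
congr (_ + _); last by congr (lam _ * _); lia.
have er : r - i.+1%:Z + 1 = r - i%:Z by lia.
rewrite er IHi 2!big_ord_recr /= {2 4}/col_transfer ltnn eqxx leqnn.
rewrite mulrDr mulrDr -addrA; congr (_ + _).
  rewrite mulr_sumr; apply: eq_bigr => k _.
  rewrite /col_transfer ltn_ord ltnS (ltnW (ltn_ord k)) !mulrA; congr (_ * _ * _).
  by rewrite divfK.
rewrite -mulrDr -mulrDl mulrA; congr (_ * (_ + mu _) * _); lia.
Qed.

(* The weight of the paths from the last cell [(r - 1, c)] outside row [r] to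
   [(r, c + d)], up to the factor [a (r - 1) c]. *)
Definition row_transfer (r c : int) (d : nat) : F :=
  (path_weight 0 d r c
   + (if d is d'.+1 then mu (r - 1 + c - n) * path_weight 0 d' r (c + 1) else 0))
  / a r c.

(** Here [c + k] is the column where the path leaves row [r - 1]. The entry there, missing from
    [row_transfer], is the end entry counted by [path_weight i k]. *)
Lemma path_weight_row_transfer i q (r c : int) :
  path_weight i.+1 q (r - i.+1%:Z) c
  = \sum_(k < q.+1)
      path_weight i k (r - 1 - i%:Z) c * row_transfer r (c + k%:Z) (q - k).
Proof.
have es (j : nat) : r - j.+1%:Z = r - 1 - j%:Z by lia.
elim: q i c => [|q IHq] i c.
  rewrite big_ord1 !path_weight0 /row_transfer path_weight0 /= !addr0.
  by rewrite divff // mulr1 es.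
have ec (k : nat) : c + 1 + k%:Z = c + k.+1%:Z by lia.
have c0 : c + 0%:Z = c by lia.
have IHq1 j : path_weight j.+1 q (r - j.+1%:Z) (c + 1)
    = \sum_(k < q.+1) path_weight j k (r - 1 - j%:Z) (c + 1)
                     * row_transfer r (c + k.+1%:Z) (q - k).
  by rewrite IHq; apply: eq_bigr => k _; rewrite ec.
elim: i => [|i IHi].
  rewrite path_weightSS IHq1 [RHS]big_ord_recl /= subn0 path_weight0 subr0 c0.
  rewrite subrK [LHS]addrC; congr (_ + _).
    by rewrite /row_transfer mulrAC !mulrA.
  rewrite mulr_sumr; apply: eq_bigr => k _.
  by rewrite /= path_weight0S mulrA.
rewrite path_weightSS IHq1 [RHS]big_ord_recl /= subn0 path_weight0 c0.
have er : r - i.+2%:Z + 1 = r - i.+1%:Z by lia.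
rewrite er IHi [\sum_(k < q.+2) _]big_ord_recl /= subn0 path_weight0 c0 IHq1.
rewrite [LHS]addrC.
rewrite -addrA mulrDr -addrA -!es; congr (_ + _).
  by rewrite mulrA divfK.
rewrite !mulr_sumr -big_split mulr_sumr -big_split; apply: eq_bigr => k _ /=.
rewrite path_weightSS er; ring.
Qed.

Lemma det_path_mx_shift_col m (r c : int) :
  \det (\matrix_(i < m, j < m) path_weight i j.+1 (r - i%:Z) c)
  = \prod_(i < m) lam (c - r + i%:Z) * \det (path_mx m r (c + 1)).
Proof.
pose Q : 'M[F]_m := \matrix_(i, k) col_transfer r c i k.
have -> : \matrix_(i < m, j < m) path_weight i j.+1 (r - i%:Z) c
        = Q *m path_mx m r (c + 1).
  apply/matrixP=> i j; rewrite !mxE path_weight_col_transfer.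
  rewrite (big_ord_widen m (fun k => col_transfer r c i k
    * path_weight k j (r - k%:Z) (c + 1))) //.
  rewrite big_mkcond; apply: eq_bigr => k _; rewrite !mxE ltnS leq_eqVlt.
  rewrite /col_transfer; case: ltngtP => //=; rewrite ?mul0r //.
rewrite det_mulmx det_trig; last first.
  apply/is_trig_mxP => i j ij; rewrite mxE /col_transfer; case: ltngtP ij => //.
by congr (_ * _); apply: eq_bigr => i _; rewrite mxE /col_transfer ltnn eqxx.
Qed.

Lemma det_path_mx_shift_row m (r c : int) :
  \det (\matrix_(i < m, j < m) path_weight i.+1 j (r - i.+1%:Z) c)
  = \det (path_mx m (r - 1) c).
Proof.
pose R : 'M[F]_m :=
  \matrix_(k, j) if (k <= j)%N then row_transfer r (c + k%:Z) (j - k) else 0.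
have -> : \matrix_(i < m, j < m) path_weight i.+1 j (r - i.+1%:Z) c
        = path_mx m (r - 1) c *m R.
  apply/matrixP=> i j; rewrite !mxE path_weight_row_transfer.
  rewrite (big_ord_widen m (fun k => path_weight i k (r - 1 - i%:Z) c
    * row_transfer r (c + k%:Z) (j - k))) //.
  rewrite big_mkcond; apply: eq_bigr => k _; rewrite !mxE ltnS.
  by case: ifP; rewrite ?mulr0.
rewrite det_mulmx -[\det R]det_tr [\det R^T]det_trig; last first.
  by apply/is_trig_mxP => i j ij; rewrite !mxE leqNgt ij.
rewrite big1 ?mulr1 // => i _; rewrite !mxE leqnn subnn /row_transfer.
by rewrite path_weight0 addr0 divff.
Qed.

Lemma det_path_mx_rec m (r c : int) :
  \det (path_mx m.+2 r c) * \det (path_mx m (r - 1) (c + 1))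
  = mu (r + c - 1 - n) * \det (path_mx m.+1 r (c + 1))
      * \det (path_mx m.+1 (r - 1) c)
    + lam (c - r + m.+1%:Z) * \det (path_mx m.+1 (r - 1) (c + 1))
      * \det (path_mx m.+1 r c).
Proof.
pose l0 := lam (c - r); pose u := mu (r + c - 1 - n).
(* Subtracting [s i] times row 0 from row [i] removes the paths that enter column
   [c + 1] in row [r]; it also scales column 0, outside row 0, by [- u / l0]. *)
pose s (i : nat) : F := if i is 0%N then 0 else col_transfer r c i 0 / l0.
pose W (i j : nat) : F := path_weight i j (r - i%:Z) c.
pose W' (i j : nat) : F := W i j - s i * W 0%N j.
pose M k i0 j0 : 'M[F]_k := \matrix_(i < k, j < k) W' (i + i0)%N (j + j0)%N.
have l0_neq0 : l0 != 0 by exact: lam_neq0.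
have fromtop k j0 : \det (M k.+1 0%N j0)
    = \det (\matrix_(i < k.+1, j < k.+1) W i (j + j0)%N).
  set B := (X in _ = \det X).
  rewrite -[RHS]mul1r -[X in X * _](subr0 1) -(det_sub_row0 B (fun i => s i)).
  by congr (\det _); apply/matrixP=> i j; rewrite !mxE /W' addn0.
(* Since [W 0 j.+1] is [l0 * path_weight 0 j r (c + 1)], the subtraction removes exactly the term
   [k = 0] of the column cut. *)
have W'S i j : W' i.+1 j.+1 = \sum_(k < i.+1) col_transfer r c i.+1 k.+1
    * path_weight k.+1 j (r - k.+1%:Z) (c + 1).
  rewrite /W' /W !path_weight_col_transfer big_ord_recl big_ord1 /=.
  have -> : col_transfer r c 0 0 = l0 by rewrite /col_transfer /= addr0.
  by rewrite mulrA divfK // addrAC subrr add0r.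
have inner k : \det (M k 1%N 1%N)
    = \prod_(i < k) lam (c - r + i.+1%:Z) * \det (path_mx k (r - 1) (c + 1)).
  rewrite -det_path_mx_shift_row.
  pose Q : 'M[F]_k := \matrix_(i, j) col_transfer r c i.+1 j.+1.
  have -> : M k 1%N 1%N
    = Q *m \matrix_(i < k, j < k) path_weight i.+1 j (r - i.+1%:Z) (c + 1).
    apply/matrixP=> i j; rewrite !mxE !addn1 W'S.
    rewrite (big_ord_widen k (fun t => col_transfer r c i.+1 t.+1
      * path_weight t.+1 j (r - t.+1%:Z) (c + 1))) //.
    rewrite big_mkcond; apply: eq_bigr => t _; rewrite !mxE ltnS leq_eqVlt.
    by rewrite /col_transfer ltnS eqSS; case: ltngtP => //=; rewrite ?mul0r.
  rewrite det_mulmx det_trig; last first.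
    apply/is_trig_mxP => i j ij; rewrite mxE /col_transfer ltnS eqSS.
    by case: ltngtP ij.
  by congr (_ * _); apply: eq_bigr => i _; rewrite mxE /col_transfer ltnn eqxx.
have corner k : \det (M k.+1 1%N 0%N) = - (u / l0) * \det (path_mx k.+1 (r - 1) c).
  rewrite -det_path_mx_shift_row; set B := (X in _ * \det X).
  (* As [s i.+1] is [1 + u / l0] times [a (r - i.+1) c / a r c], and column 0 holds
     [a (r - i.+1) c], the row correction is also a column operation, with [t 0 = 1 + u / l0]. *)
  pose t (j : 'I_k.+1) : F := (1 + u / l0) / a r c * W 0%N j.
  have -> : - (u / l0) = 1 - t 0.
    by rewrite /t /W path_weight0 subr0 divfK // opprD addrA subrr add0r.
  rewrite -det_sub_col0; congr (\det _); apply/matrixP=> i j.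
  rewrite !mxE addn0 addn1 /W' path_weight0; congr (_ - _).
  rewrite /t /s /W /col_transfer /= subr0 !addr0 mulrA; congr (_ * _).
  rewrite -/l0 -/u; field.
  by rewrite l0_neq0 a_neq0.
have := desnanot_jacobi (M m.+2 0%N 0%N).
have -> : \matrix_(i < m, j < m) M m.+2 0%N 0%N (lift ord0 (lift ord_max i))
    (lift ord0 (lift ord_max j)) = M m 1%N 1%N.
  by apply/matrixP=> i j; rewrite !mxE !addn0 !addn1 !lift0 !lift_max.
have -> : row' ord_max (col' ord_max (M m.+2 0%N 0%N)) = M m.+1 0%N 0%N.
  by apply/matrixP=> i j; rewrite !mxE !lift_max.
have -> : row' ord0 (col' ord0 (M m.+2 0%N 0%N)) = M m.+1 1%N 1%N.
  by apply/matrixP=> i j; rewrite !mxE !lift0 !addn0 !addn1.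
have -> : row' ord_max (col' ord0 (M m.+2 0%N 0%N)) = M m.+1 0%N 1%N.
  by apply/matrixP=> i j; rewrite !mxE lift_max lift0 !addn0 !addn1.
have -> : row' ord0 (col' ord_max (M m.+2 0%N 0%N)) = M m.+1 1%N 0%N.
  by apply/matrixP=> i j; rewrite !mxE lift_max lift0 !addn0 !addn1.
have top0 k : \det (M k.+1 0%N 0%N) = \det (path_mx k.+1 r c).
  by rewrite fromtop; congr (\det _); apply/matrixP=> i j; rewrite !mxE addn0.
have top1 k : \det (M k.+1 0%N 1%N)
    = \prod_(i < k.+1) lam (c - r + i%:Z) * \det (path_mx k.+1 r (c + 1)).
  rewrite fromtop -det_path_mx_shift_col; congr (\det _).
  by apply/matrixP=> i j; rewrite !mxE addn1.
rewrite !top0 top1 !inner corner big_ord_recl /= addr0 -/l0.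
rewrite [\prod_(i < m.+1) _]big_ord_recr /= -/u.
(* Every term contains [P]; the extra [l0] from [top1] cancels the denominator from [corner], and
   the extra last factor of [inner] is the coefficient [lam]. *)
set P := \prod_(i < m) _.
have P0 : P != 0 by apply/prodf_neq0 => i _; exact: lam_neq0.
move=> e; apply: (mulfI P0); rewrite mulrCA e; field.
exact: l0_neq0.
Qed.

End PathMatrix.

Arguments path_weight : simpl never.

(** * The generic T-system *)
Section GenericValue.
Variables (K : fieldType) (N : nat) (pt : 'I_N -> K).
Local Notation R := {fraction {mpoly K[N]}}.

Lemma has_value0 : has_value pt (0 : R) 0.
Proof. by have := has_value_poly pt 0; rewrite tofrac0 meval0. Qed.

Lemma has_value_det m (B : 'M[R]_m) (B' : 'M[K]_m) :
  (forall i j, has_value pt (B i j) (B' i j)) ->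
  has_value pt (\det B) (\det B').
Proof.
move=> BB'; rewrite /determinant.
apply: (big_rec2 (fun x y => has_value pt x y)); first exact: has_value0.
move=> s x y _ xy; apply: has_valueD xy; apply: has_valueM.
  case: (perm.odd_perm s); rewrite ?expr0 ?expr1; last exact: has_value1.
  by have := has_value_poly pt (-1); rewrite tofracN tofrac1 mevalN meval1.
apply: (big_rec2 (fun x y => has_value pt x y)); first exact: has_value1.
by move=> i u v _ uv; apply: has_valueM uv.
Qed.

End GenericValue.

Section GenericSystem.
Variables (K : fieldType) (n : nat).

Lemma indet_neq0 (v : var n) : indet K v != 0.
Proof.
apply: (@has_value_neq0 K _ (fun=> 1) _ 1); last exact: oner_neq0.
have := has_value_poly (fun=> 1 : K) 'X_(enum_rank v).
by rewrite mevalXU.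
Qed.

(* The dummy value 1 outside the matrix makes the array nonzero everywhere. *)
Definition generic_entry (r c : int) : ratfun K n :=
  if (1 <= r <= n%:Z) && (1 <= c <= n%:Z) then entry (generic_mx K n) r c else 1.

Lemma generic_entry_neq0 r c : generic_entry r c != 0.
Proof.
rewrite /generic_entry; case: ifP => [/andP[rn cn]|_]; last exact: oner_neq0.
apply: (@has_value_neq0 K _ (point (const_mx 1) (fun=> 1) (fun=> 1)) _ 1);
  last exact: oner_neq0.
have e : entry (const_mx 1 : 'M[K]_n) r c = 1.
  case: r c rn cn => [[|r]|r] [[|c]|c] // rn cn.
  have {}rn : (r < n)%N by lia.
  have {}cn : (c < n)%N by lia.
  rewrite /entry (insubT (fun r => r < n)%N rn).
  by rewrite (insubT (fun r => r < n)%N cn) mxE.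
rewrite -[X in has_value _ _ X]e; apply: entry_generic; lia.
Qed.

Definition generic_path_mx :=
  path_mx n%:Z generic_entry (@generic_lam K n) (@generic_mu K n).

(* The determinant of the [k x k] block centered at the position of [T_{i,j,1}]. *)
Definition generic_T (i j : int) (k : nat) : ratfun K n :=
  \det (generic_path_mx k ((j - i + n%:Z + k%:Z) %/ 2)%Z
                          (((i + j + n%:Z - k%:Z) %/ 2)%Z + 1)).

Lemma generic_T_system :
  T_system (generic_mx K n) (@generic_lam K n) (@generic_mu K n) generic_T.
Proof.
split.
- by move=> i j _ _; rewrite /generic_T det_mx00.
- move=> i j pij le_n; rewrite /generic_T det_mx11 mxE /= path_weight0 subr0.
  have -> : ((i + j + n%:Z - 1%N%:Z) %/ 2)%Z + 1 = ((i + j + n%:Z + 1) %/ 2)%Z.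
    by lia.
  by rewrite /generic_entry ifT //; lia.
move=> i j [|k] // _ pij le_n /=.
set r := ((j - i + n%:Z + k.+2%:Z) %/ 2)%Z.
set c := ((i + j + n%:Z - k.+2%:Z) %/ 2)%Z + 1.
have TE i' j' k' r' c' : ((j' - i' + n%:Z + k'%:Z) %/ 2)%Z = r' ->
    ((i' + j' + n%:Z - k'%:Z) %/ 2)%Z + 1 = c' ->
    generic_T i' j' k' = \det (generic_path_mx k' r' c').
  by move=> <- <-.
rewrite (TE i j k.+2 r c) //.
rewrite (TE i j k (r - 1) (c + 1)); [|rewrite /r; lia|rewrite /c; lia].
rewrite (TE i (j + 1) k.+1 r (c + 1)); [|rewrite /r; lia|rewrite /c; lia].
rewrite (TE i (j - 1) k.+1 (r - 1) c); [|rewrite /r; lia|rewrite /c; lia].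
rewrite (TE (i + 1) j k.+1 (r - 1) (c + 1)); [|rewrite /r; lia|rewrite /c; lia].
rewrite (TE (i - 1) j k.+1 r c); [|rewrite /r; lia|rewrite /c; lia].
rewrite det_path_mx_rec; first last.
- by move=> s; exact: indet_neq0.
- exact: generic_entry_neq0.
(* The parameters agree because [r + c - 1 - n = j] and [c - r + k.+1 = i]. *)
by congr (generic_mu K n _ * _ * _ + generic_lam K n _ * _ * _); rewrite /r /c; lia.
Qed.

End GenericSystem.

(** The bounds keep the paths inside the matrix: the dummy entries are never met, the parameter
    indices stay between [-n] and [n], and the only denominators are nonzero entries. *)
Lemma generic_path_weight_value (K : fieldType) (n : nat) (A : 'M[K]_n)
    (lam mu : int -> K) (a : int -> int -> K) :
  (forall r c, a r c != 0) ->
  (forall r c : int, 1 <= r <= n%:Z -> 1 <= c <= n%:Z -> a r c = entry A r c) ->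
  forall (p q : nat) (r c : int), 1 <= r -> r + p%:Z <= n%:Z ->
    1 <= c -> c + q%:Z <= n%:Z ->
  has_value (point A lam mu)
    (path_weight n%:Z (generic_entry K n) (@generic_lam K n) (@generic_mu K n)
       p q r c)
    (path_weight n%:Z a lam mu p q r c).
Proof.
move=> a0 aA.
have ga (r c : int) : 1 <= r <= n%:Z -> 1 <= c <= n%:Z ->
    has_value (point A lam mu) (generic_entry K n r c) (a r c).
  move=> rn cn; rewrite /generic_entry rn cn /= aA //.
  by apply: entry_generic; lia.
elim=> [|p IHp]; elim=> [|q IHq] r c r1 rn c1 cn.
- by rewrite !path_weight0; apply: ga; lia.
- rewrite !path_weight0S; apply: has_valueM; last by apply: IHq; lia.
  by apply: lam_generic; lia.
- by rewrite !path_weight0; apply: ga; lia.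
rewrite !path_weightSS; apply: has_valueD.
  apply: has_valueM; last by apply: IHq; lia.
  by apply: lam_generic; lia.
apply: has_valueM.
  apply: has_valueM; first by apply: ga; lia.
  by apply: has_valueV => //; apply: ga; lia.
apply: has_valueD; first by apply: IHp; lia.
apply: has_valueM; last by apply: IHp; lia.
by apply: mu_generic; lia.
Qed.

(** * Matrix elements of the resolvent *)

Section Resolvent.
Variables (K : fieldType) (n : nat) (lam mu : int -> K) (alpha : site -> K).
Hypothesis alpha_neq0 : forall p, alpha p != 0.

Local Notation T := (T_op n lam mu alpha).

Lemma T_op_is_linear : linear T.
Proof.
move=> x u v; rewrite /T_op /w_op /z_op /shift_op /diag_op !linearP /=.
by rewrite (addrACA (x *: _)) (addrACA (x *: _ + x *: _)) !scalerDr.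
Qed.

Fact cell_subproof (r c : int) :
  (2 %| (r - n%:Z + c - 1, c - r + n%:Z - 1).1
        + (r - n%:Z + c - 1, c - r + n%:Z - 1).2)%Z.
Proof. by rewrite /=; lia. Qed.

(* The site where [alpha] is [a_{r,c}]. *)
Definition cell (r c : int) : site := Sub (_, _) (cell_subproof r c).

Lemma xco_cell (r c : int) : xco (cell r c) = r - n%:Z + c - 1.
Proof. by []. Qed.

Lemma yco_cell (r c : int) : yco (cell r c) = c - r + n%:Z - 1.
Proof. by []. Qed.

Lemma xco_shift (dx dy : int) (d : (2 %| dx + dy)%Z) p :
  xco (shift d p) = xco p + dx.
Proof. by []. Qed.

Lemma yco_shift (dx dy : int) (d : (2 %| dx + dy)%Z) p :
  yco (shift d p) = yco p + dy.
Proof. by []. Qed.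

Lemma site_eq (s t : site) : xco s = xco t -> yco s = yco t -> s = t.
Proof.
rewrite /xco /yco => ex ey; apply: val_inj.
by rewrite (surjective_pairing (val s)) ex ey -surjective_pairing.
Qed.

Let a r c := alpha (cell r c).

Lemma diag_opZ f x (v : Hspace K) : diag_op f (x *: v) = x *: diag_op f v.
Proof. exact: linearZ. Qed.

Lemma w_opZ x (v : Hspace K) : w_op (x *: v) = x *: w_op v.
Proof. exact: linearZ. Qed.

Lemma z_opZ x (v : Hspace K) : z_op (x *: v) = x *: z_op v.
Proof. exact: linearZ. Qed.

Lemma diag_op_ket f p : diag_op f (ket K p) = f p *: ket K p.
Proof. exact: linext_ket. Qed.

Lemma w_op_ket (r c : int) : w_op (ket K (cell r c)) = ket K (cell r (c + 1)).
Proof.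
rewrite /w_op /shift_op linext_ket; congr ket.
by apply: site_eq; rewrite ?(xco_shift, yco_shift) !(xco_cell, yco_cell); lia.
Qed.

Lemma z_op_ket (r c : int) : z_op (ket K (cell r c)) = ket K (cell (r + 1) c).
Proof.
rewrite /z_op /shift_op linext_ket; congr ket.
by apply: site_eq; rewrite ?(xco_shift, yco_shift) !(xco_cell, yco_cell); lia.
Qed.

Lemma w_inv_ket (r c : int) : w_inv (ket K (cell r c)) = ket K (cell r (c - 1)).
Proof.
rewrite /w_inv /shift_op linext_ket; congr ket.
by apply: site_eq; rewrite ?(xco_shift, yco_shift) !(xco_cell, yco_cell); lia.
Qed.

Lemma z_inv_ket (r c : int) : z_inv (ket K (cell r c)) = ket K (cell (r - 1) c).
Proof.
rewrite /z_inv /shift_op linext_ket; congr ket.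
by apply: site_eq; rewrite ?(xco_shift, yco_shift) !(xco_cell, yco_cell); lia.
Qed.

(** In cell coordinates [w_op] moves right and [z_op] down, and conjugation by [alpha] gives the
    ratios of entries: [T] performs one step of a weighted path. *)
Lemma T_op_ket (r c : int) :
  T (ket K (cell r c)) = lam (c - r) *: ket K (cell r (c + 1))
  + (a r c / a (r + 1) c) *: ket K (cell (r + 1) c)
  + (mu (r + c - n%:Z) * (a r c / a (r + 1) c)) *: ket K (cell (r + 1) (c + 1)).
Proof.
rewrite /T_op !diag_op_ket !(diag_opZ, z_opZ, w_opZ) z_op_ket.
rewrite !(diag_opZ, w_opZ, diag_op_ket) !(w_opZ, w_op_ket) !scalerA.
rewrite -addrA [X in _ + X]addrC addrA -/(a _ _) -/(a _ _).
congr (_ *: _ + _ *: _ + _ *: _).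
- by congr lam; rewrite yco_cell; lia.
- by rewrite mulrC; congr (mu _ * _); rewrite xco_cell; lia.
Qed.

Lemma iter_T_op_is_linear k : linear (iter k T).
Proof. by elim: k => // k IHk x u v /=; rewrite IHk T_op_is_linear. Qed.

Variable q0 : nat.

Definition end_form (v : Hspace K) : K :=
  bra site0 (iter q0 (@w_inv K) (diag_op alpha v)).

Lemma end_form_is_linear x u v : end_form (x *: u + v) = x * end_form u + end_form v.
Proof.
rewrite /end_form /bra /diag_op linearP /=.
move: (linext _ u) (linext _ v) => {}u {}v.
elim: q0 u v => [|q IHq] u v; first by rewrite /= coeffD coeffZ.
by rewrite !iterSr /w_inv /shift_op linearP IHq.
Qed.

Lemma end_form_ket (r c : int) :
  end_form (ket K (cell r c)) = a r c * ((r == n%:Z) && (c == q0%:Z + 1))%:R.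
Proof.
rewrite /end_form /diag_op linext_ket -/(a r c).
have -> : iter q0 (@w_inv K) (a r c *: ket K (cell r c))
        = a r c *: ket K (cell r (c - q0%:Z)).
  elim: q0 => [|q IHq] /=; first by rewrite subr0.
  rewrite IHq [w_inv _]linearZ /= [linext _ _]w_inv_ket.
  by congr (_ *: ket _ (cell _ _)); lia.
rewrite /bra coeffZ /ket coeffU mul1r; congr (_ * (nat_of_bool _)%:R).
apply/eqP/andP => [e | [/eqP-> /eqP->]]; last first.
  by apply: site_eq; rewrite ?(xco_cell, yco_cell) /xco /yco /=; lia.
have := congr1 xco e; have := congr1 yco e.
rewrite xco_cell yco_cell /xco /yco /= => e1 e2.
by split; apply/eqP; lia.
Qed.

Definition partial_resolvent N v := \sum_(k < N) end_form (iter k T v).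

Lemma partial_resolventS N (r c : int) :
  partial_resolvent N.+1 (ket K (cell r c)) = end_form (ket K (cell r c))
  + (lam (c - r) * partial_resolvent N (ket K (cell r (c + 1)))
     + a r c / a (r + 1) c * (partial_resolvent N (ket K (cell (r + 1) c))
       + mu (r + c - n%:Z) * partial_resolvent N (ket K (cell (r + 1) (c + 1))))).
Proof.
rewrite /partial_resolvent big_ord_recl; congr (_ + _).
rewrite mulrDr !mulr_sumr -!big_split; apply: eq_bigr => k _ /=.
rewrite -iterS iterSr T_op_ket -addrA iter_T_op_is_linear end_form_is_linear.
congr (_ + _).
rewrite iter_T_op_is_linear end_form_is_linear; congr (_ + _).
have lin0 x v : end_form (iter k T (x *: v)) = x * end_form (iter k T v).
  have z : iter k T 0 = 0.
    by have := iter_T_op_is_linear k (-1) 0 0; rewrite scaler0 addr0 scaleN1r addNr.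
  have f0 : end_form 0 = 0.
    by have := end_form_is_linear (-1) 0 0; rewrite scaler0 addr0 mulN1r addNr.
  by rewrite -[x *: v]addr0 iter_T_op_is_linear z end_form_is_linear f0 addr0.
by rewrite lin0 [RHS]mulrCA !mulrA.
Qed.

(** Steps never decrease the row or the column, so the end cell is out of reach. *)
Lemma partial_resolvent_outside N (r c : int) :
  (n%:Z < r) || (q0%:Z + 1 < c) -> partial_resolvent N (ket K (cell r c)) = 0.
Proof.
elim: N r c => [|N IHN] r c rc; first by rewrite /partial_resolvent big_ord0.
rewrite partial_resolventS !IHN; try lia.
rewrite end_form_ket !mulr0 addr0 mulr0 !addr0.
by rewrite (_ : _ && _ = false) ?mulr0 //; lia.
Qed.

(** A path to the end cell from [p] rows above and [q] columns to its left has at most [p + q]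
    steps, so the truncated series sees all of them; both sides obey the same first-step
    recursion. *)
Lemma partial_resolventE N p q : (p + q < N)%N ->
  partial_resolvent N (ket K (cell (n%:Z - p%:Z) (q0%:Z + 1 - q%:Z)))
  = path_weight n%:Z a lam mu p q (n%:Z - p%:Z) (q0%:Z + 1 - q%:Z).
Proof.
elim: N p q => // N IHN p q pq; rewrite partial_resolventS end_form_ket.
set r := n%:Z - _; set c := q0%:Z + 1 - _.
case: q @c pq => [|q] c pq.
  rewrite (@partial_resolvent_outside N r (c + 1)); last by rewrite /c; lia.
  rewrite (@partial_resolvent_outside N (r + 1) (c + 1)); last by rewrite /c; lia.
  rewrite !mulr0 add0r addr0 path_weight0.
  case: p @r pq => [|p] r pq.
    rewrite (@partial_resolvent_outside N (r + 1) c); last by rewrite /r; lia.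
    by rewrite (_ : _ && _) ?mulr1 ?mulr0 ?addr0 // /r /c; lia.
  rewrite (_ : _ && _ = false) ?mulr0 ?add0r; last by rewrite /r; lia.
  have er : r + 1 = n%:Z - p%:Z by rewrite /r; lia.
  by rewrite er IHN ?path_weight0 ?divfK; [..|lia]; last exact: alpha_neq0.
rewrite (_ : _ && _ = false) ?mulr0 ?add0r; last by rewrite /c; lia.
have ec : c + 1 = q0%:Z + 1 - q%:Z by rewrite /c; lia.
case: p @r pq => [|p] r pq.
  rewrite (@partial_resolvent_outside N (r + 1) c); last by rewrite /r; lia.
  rewrite (@partial_resolvent_outside N (r + 1) (c + 1)); last by rewrite /r; lia.
  by rewrite !(mulr0, addr0) path_weight0S ec IHN; last lia.
have er : r + 1 = n%:Z - p%:Z by rewrite /r; lia.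
by rewrite path_weightSS ec er (IHN p.+1 q) ?(IHN p q.+1) ?(IHN p q) //; lia.
Qed.

Lemma resolvent_eltE p :
  resolvent_elt end_form T (ket K (cell (n%:Z - p%:Z) 1))
    (path_weight n%:Z a lam mu p q0 (n%:Z - p%:Z) 1).
Proof.
have E N : (p + q0 < N)%N -> partial_resolvent N (ket K (cell (n%:Z - p%:Z) 1))
    = path_weight n%:Z a lam mu p q0 (n%:Z - p%:Z) 1.
  have e1 : q0%:Z + 1 - q0%:Z = 1 by lia.
  by move=> /partial_resolventE; rewrite e1.
exists (p + q0).+1 => [k pk|]; last by rewrite -(E (p + q0).+1).
(* The truncations at [k] and [k.+1] have the same value, so the [k]-th term vanishes. *)
have := E _ (leqW pk); rewrite -(E _ pk) /partial_resolvent big_ord_recr /=.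
by rewrite -[RHS]addr0 => /addrI.
Qed.

End Resolvent.


(* Rows and columns are numbered from 0 in 'I_n, so that z^{1-i} and w^{1-j}
   become the i-th and j-th powers of the inverse operators. *)
Theorem theorem5p7 (K : fieldType) (n : nat) (A : 'M[K]_n) (lam mu : int -> K)
    (alpha : site -> K) :
  (1 <= n)%N ->
  (forall r c, A r c != 0) ->
  (forall p, alpha p != 0) ->
  (forall p : site,
     let r := ((xco p - yco p) %/ 2)%Z + n%:Z in
     let c := ((xco p + yco p) %/ 2)%Z + 1 in
     1 <= r <= n%:Z -> 1 <= c <= n%:Z -> alpha p = entry A r c) ->
  exists2 M : 'M[K]_n,
    forall i j : 'I_n,
      resolvent_elt
        (fun v => bra site0 (iter j (@w_inv K) (diag_op alpha v)))
        (T_op n lam mu alpha)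
        (iter i (@z_inv K) (ket K site0))
        (M i j)
    & is_lambda_det A lam mu (\det M).
Proof.
move=> _ _ alpha0 alphaA; pose a r c := alpha (cell n r c).
exists (path_mx n%:Z a lam mu n n%:Z 1) => [i j|].
  have -> : iter i (@z_inv K) (ket K site0) = ket K (cell n (n%:Z - i%:Z) 1).
    elim: (i : nat) => [|k IHk] /=.
      by congr ket; apply: site_eq; rewrite ?(xco_cell, yco_cell) /xco /yco /=; lia.
    by rewrite IHk z_inv_ket; congr (ket _ (cell _ _ _)); lia.
  by rewrite mxE; exact: resolvent_eltE.
(* For [i = j = 0] and [k = n] the block is the whole matrix, with lower left corner [(n, 1)]; its
   determinant is specialized entry by entry. *)
exists (generic_T K n); first exact: generic_T_system.
apply: has_value_det => i j; rewrite !mxE.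
have -> : ((0 - 0 + n%:Z + n%:Z) %/ 2)%Z = n%:Z by lia.
have -> : ((0 + 0 + n%:Z - n%:Z) %/ 2)%Z + 1 = 1 by lia.
have [ltin ltjn] := (ltn_ord i, ltn_ord j).
apply: generic_path_weight_value; [by move=> *; exact: alpha0| |lia..].
move=> r c rn cn; have := alphaA (cell n r c).
rewrite xco_cell yco_cell /=.
have -> : ((r - n%:Z + c - 1 - (c - r + n%:Z - 1)) %/ 2)%Z + n%:Z = r by lia.
have -> : ((r - n%:Z + c - 1 + (c - r + n%:Z - 1)) %/ 2)%Z + 1 = c by lia.
exact.
Qed.
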